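(* For rooted trees $T_1,\ldots,T_k$ ($k\ge1$) and $T=\{T_1,\ldots,T_k|\bullet\}$, \[ \binom{t}{T}=\sum_{\tau_1,\ldots,\tau_k=0}^{t-1}\binom{\tau_1}{T_1}\cdots\binom{\tau_k}{T_k}, \] where the right-hand side is the $k$-fold product of the polynomials $\sum_{\tau_i=0}^{t-1}\binom{\tau_i}{T_i}$.
   Context: $\mathbb{K}$ is a field of characteristic zero. $\mathcal{T}=\prod_{n\ge1}\mathcal{T}(n)$, $\mathcal{T}(n)$ spanned by isomorphism classes of (non-planar) rooted trees with $n$ vertices, pre-Lie product $T\curvearrowright T'=\sum_{v\in V(T')}T\searrow_vT'$ ($T\searrow_vT'$: add an edge from the root of $T$ to the vertex $v$ of $T'$, keep the root of $T'$); $\bullet$ is the one-vertex tree, and $\{T_1,\ldots,T_k|\bullet\}$ is the tree obtained by joining a new root by edges to the roots of $T_1,\ldots,T_k$. With $B_k$ the Bernoulli numbers ($\frac{t}{e^t-1}=\sum\frac{B_k}{k!}t^k$) and $\langle\frac{D}{e^D-1}|\cdot\rangle$ the functional $t^n\mapsto B_n$ (extended coefficientwise), let $P=\sum_TP(T)(t)T$ (polynomial coefficients) be the solution of $P'=\langle\frac{D}{e^D-1}|P\rangle\curvearrowright P$, $P(0)=\bullet$, and set $\binom{t}{T}:=|\mathrm{Aut}(T)|P(T)(t)$. For a polynomial $q(\tau)$, $\sum_{\tau=0}^{t-1}q(\tau)$ denotes the indefinite sum: the unique polynomial $Q(t)$ with $Q(0)=0$ and $Q(t+1)-Q(t)=q(t)$.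 *)

(* Defs.v *)
From HB Require Import structures.
From mathcomp Require Import all_boot all_order all_algebra.
From mathcomp Require Import fingroup perm.

Set Implicit Arguments.
Unset Strict Implicit.
Unset Printing Implicit Defensive.

Import GRing.Theory.
Local Open Scope ring_scope.

(* A rooted tree with vertex set V is given by its root and its parent map; by
   convention the root is its own parent, and every vertex reaches the root by
   iterating the parent map.  The root is thus the only fixed point of the
   parent map, and the edges are the pairs (v, parent v) for v other than the
   root. *)
Definition is_rtree (V : finType) (d : V * {ffun V -> V}) : bool :=
  (d.2 d.1 == d.1) && [forall v, fconnect d.2 v d.1].

Record rtree (V : finType) := RTree {
  rtree_data : V * {ffun V -> V};
  rtreeP : is_rtree rtree_data
}.

HB.instance Definition _ (V : finType) := [isSub for @rtree_data V].
HB.instance Definition _ (V : finType) := [Finite of rtree V by <:].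

Definition tree_root (V : finType) (T : rtree V) : V := (rtree_data T).1.
Definition parent (V : finType) (T : rtree V) : V -> V := (rtree_data T).2.

Lemma parent_root (V : finType) (T : rtree V) :
  parent T (tree_root T) = tree_root T.
Proof. by have /andP[/eqP] := rtreeP T. Qed.

Lemma iter_parent (V : finType) (T : rtree V) v :
  exists n, iter n (parent T) v = tree_root T.
Proof.
have /andP[_ /forallP/(_ v) Hv] := rtreeP T.
by exists (findex (parent T) v (tree_root T)); apply: iter_findex.
Qed.

Lemma parent_fixed (V : finType) (T : rtree V) v :
  parent T v = v -> v = tree_root T.
Proof.
move=> pv; have [n <-] := iter_parent T v.
by elim: n => //= n <-.
Qed.

Lemma is_rtreeI (V : finType) (r : V) (p : V -> V) :
  p r = r -> (forall v, exists n, iter n p v = r) ->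
  is_rtree (r, [ffun v => p v]).
Proof.
move=> pr H; rewrite /is_rtree /= ffunE pr eqxx /=; apply/forallP => v.
have [n <-] := H v.
rewrite -(@eq_iter _ [ffun v => p v] p (fun=> ffunE _ _) n v).
exact: fconnect_iter.
Qed.

(* A bijection commuting with the parent maps preserves both the root (the
   unique fixed point) and the edges. *)
Definition tree_iso (V W : finType) (T : rtree V) (U : rtree W) : bool :=
  [exists f : {ffun V -> W},
    [&& injectiveb f, #|V| == #|W| &
        [forall v, f (parent T v) == parent U (f v)]]].

Definition tree_aut (V : finType) (T : rtree V) : {set {perm V}} :=
  [set s : {perm V} | [forall v, s (parent T v) == parent T (s v)]].

Lemma isoP (V W : finType) (T : rtree V) (U : rtree W) :
  reflect (exists2 f : V -> W,
             bijective f & forall v, f (parent T v) = parent U (f v))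
          (tree_iso T U).
Proof.
apply: (iffP existsP) => [[f /and3P[/injectiveP injf /eqP cVW /forallP fp]]|].
  exists f => [|v]; last exact/eqP.
  by apply: inj_card_bij => //; rewrite cVW.
case=> f bijf fp; exists [ffun v => f v]; apply/and3P; split.
- by apply/injectiveP => x y; rewrite !ffunE => /(bij_inj bijf).
- by rewrite (bij_eq_card bijf).
- by apply/forallP => v; rewrite !ffunE fp.
Qed.

Lemma iso_root (V W : finType) (T : rtree V) (U : rtree W) (f : V -> W) :
  (forall v, f (parent T v) = parent U (f v)) -> f (tree_root T) = tree_root U.
Proof. by move=> fp; apply: parent_fixed; rewrite -fp parent_root. Qed.

Lemma iso_refl (V : finType) (T : rtree V) : tree_iso T T.
Proof. by apply/isoP; exists id => //; exists id. Qed.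

Lemma iso_sym (V W : finType) (T : rtree V) (U : rtree W) :
  tree_iso T U = tree_iso U T.
Proof.
suff H V' W' (T' : rtree V') (U' : rtree W') : tree_iso T' U' -> tree_iso U' T'.
  by apply/idP/idP; apply: H.
case/isoP => f [g fK gK] fp; apply/isoP; exists g; first by exists f.
by move=> w; apply: (can_inj fK); rewrite fp !gK.
Qed.

Lemma iso_trans (V W X : finType) (T : rtree V) (U : rtree W) (S : rtree X) :
  tree_iso T U -> tree_iso U S -> tree_iso T S.
Proof.
case/isoP => f bf fp /isoP[g bg gp]; apply/isoP; exists (g \o f).
  exact: bij_comp.
by move=> v /=; rewrite fp gp.
Qed.

Lemma iso_card (V W : finType) (T : rtree V) (U : rtree W) :
  tree_iso T U -> #|V| = #|W|.
Proof. by case/isoP => f /bij_eq_card. Qed.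

Lemma dot_subproof : is_rtree (tt, [ffun v : unit => v]).
Proof. by apply: is_rtreeI => // -[]; exists 0%N. Qed.

Definition dot_tree : rtree unit := RTree dot_subproof.

Section Graft.
Variables (V W : finType) (T : rtree V) (w : W) (U : rtree W).

Definition graft_parent (x : V + W) : V + W :=
  match x with
  | inl v => if v == tree_root T then inr w else inl (parent T v)
  | inr u => inr (parent U u)
  end.

Lemma graft_subproof :
  is_rtree (inr (tree_root U) : V + W, [ffun x => graft_parent x]).
Proof.
apply: is_rtreeI => [|x]; first by rewrite /= parent_root.
have Hr u : exists n, iter n graft_parent (inr u) = inr (tree_root U).
  have [n <-] := iter_parent U u; exists n.
  by elim: n => //= n ->.
case: x => [v|u]; last exact: Hr.
have [n] := iter_parent T v; elim: n v => [|n IHn] v.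
  move=> /= ->; have [m Hm] := Hr w.
  by exists m.+1; rewrite iterSr /= eqxx.
rewrite iterSr => /IHn[m Hm].
case vr: (v == tree_root T).
  have [m' Hm'] := Hr w.
  by exists m'.+1; rewrite iterSr /= vr.
by exists m.+1; rewrite iterSr /= vr.
Qed.

Definition graft : rtree (V + W)%type := RTree graft_subproof.

End Graft.

Section Join.
Variables (k : nat) (V : 'I_k -> finType) (T : forall i, rtree (V i)).

Definition join_parent (x : option {i : 'I_k & V i}) :
    option {i : 'I_k & V i} :=
  if x is Some (existT i v) then
    if v == tree_root (T i) then None else Some (existT _ i (parent (T i) v))
  else None.

Lemma join_subproof : is_rtree (None, [ffun x => join_parent x]).
Proof.
apply: is_rtreeI => // -[[i v]|]; last by exists 0%N.
have [n] := iter_parent (T i) v; elim: n v => [|n IHn] v.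
  by move=> /= ->; exists 1%N; rewrite /= eqxx.
rewrite iterSr => /IHn[m Hm].
case vr: (v == tree_root (T i)); first by exists 1%N; rewrite /= vr.
by exists m.+1; rewrite iterSr /= vr.
Qed.

(* The tree {T_1, ..., T_k | dot_tree}. *)
Definition join_tree : rtree (option {i : 'I_k & V i}) := RTree join_subproof.

End Join.

(* One representative of each isomorphism class of rooted trees with n
   vertices. *)
Definition reps (n : nat) : {set rtree 'I_n} :=
  transversal (equivalence_partition (@tree_iso 'I_n 'I_n) setT) setT.

Lemma iso_equiv n :
  {in [set: rtree 'I_n] & &, equivalence_rel (@tree_iso 'I_n 'I_n)}.
Proof.
move=> T U S _ _ _; split; first exact: iso_refl.
move=> TU; apply/idP/idP; last exact: iso_trans.
by apply: iso_trans; rewrite iso_sym.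
Qed.

Lemma reps_iso n (V : finType) (T : rtree V) :
  #|V| = n -> exists2 U : rtree 'I_n, U \in reps n & tree_iso U T.
Proof.
move=> <-.
pose p (x : 'I_#|V|) : 'I_#|V| := enum_rank (parent T (enum_val x)).
have pit m x : iter m p x = enum_rank (iter m (parent T) (enum_val x)).
  by elim: m => [|m IHm] /=; rewrite ?enum_valK // IHm /p enum_rankK.
have Hp : is_rtree (enum_rank (tree_root T), [ffun x => p x]).
  apply: is_rtreeI => [|x]; first by rewrite /p enum_rankK parent_root.
  have [m Hm] := iter_parent T (enum_val x).
  by exists m; rewrite pit Hm.
pose T' := RTree Hp.
have iT : tree_iso T' T.
  apply/isoP; exists enum_val; first exact: enum_val_bij.
  by move=> x; rewrite /parent /= ffunE /p enum_rankK.
have part := equivalence_partitionP (@iso_equiv #|V|).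
have tr := transversalP part.
have PT' : pblock (equivalence_partition (@tree_iso _ _) setT) T'
             \in equivalence_partition (@tree_iso 'I_#|V| _) setT.
  by rewrite pblock_mem // (cover_partition part) inE.
exists (transversal_repr T' (reps #|V|)
  (pblock (equivalence_partition (@tree_iso _ _) setT) T')).
  exact: (repr_mem_transversal tr).
apply: iso_trans iT.
rewrite iso_sym -(pblock_equivalence_partition (@iso_equiv #|V|)) ?inE //.
exact: (repr_mem_pblock tr).
Qed.

Lemma reps_inj n (T U : rtree 'I_n) :
  T \in reps n -> U \in reps n -> tree_iso T U -> T = U.
Proof.
move=> rT rU iTU.
have part := equivalence_partitionP (@iso_equiv n).
have tr := transversalP part.
apply: (can_in_inj (pblockK tr T)) => //.
apply: same_pblock; first by case/and3P: part.
by rewrite (pblock_equivalence_partition (@iso_equiv n)) ?inE // iso_sym.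
Qed.

(* A formal series of rooted trees with coefficients in A: a family of
   coefficients indexed by the isomorphism classes of rooted trees. *)
Record tree_series (A : Type) := TreeSeries {
  coef :> forall V : finType, rtree V -> A;
  coef_iso : forall (V W : finType) (T : rtree V) (U : rtree W),
    tree_iso T U -> coef T = coef U
}.

(* The coefficient of T in the pre-Lie product of a and b: T1 is grafted on the
   vertices v of T2, and #|T1| + #|T2| = #|T|. *)
Definition prelie (A : pzRingType) (a b : forall V : finType, rtree V -> A)
    (V : finType) (T : rtree V) : A :=
  \sum_(i < #|V|.+1) \sum_(T1 in reps i) \sum_(T2 in reps (#|V| - i))
    (a _ T1 * b _ T2) *+ #|[set v | tree_iso (graft T1 v T2) T]|.

Lemma prelie_iso (A : pzRingType) (a b : forall V : finType, rtree V -> A)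
    (V W : finType) (T : rtree V) (U : rtree W) :
  tree_iso T U -> prelie a b T = prelie a b U.
Proof.
move=> TU; rewrite /prelie (iso_card TU); apply: eq_bigr => i _.
apply: eq_bigr => T1 _; apply: eq_bigr => T2 _; congr (_ *+ _).
apply: eq_card => v; rewrite !inE; apply/idP/idP => H; apply: iso_trans H _ => //.
by rewrite iso_sym.
Qed.

Lemma eq_prelie (A : pzRingType) (a a' b b' : forall V : finType, rtree V -> A)
    (V : finType) (T : rtree V) :
  (forall (W : finType) (U : rtree W), (#|W| < #|V|)%N -> a W U = a' W U) ->
  (forall (W : finType) (U : rtree W), (#|W| < #|V|)%N -> b W U = b' W U) ->
  prelie a b T = prelie a' b' T.
Proof.
move=> Ha Hb; rewrite /prelie; apply: eq_bigr => i _.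
apply: eq_bigr => T1 _; apply: eq_bigr => T2 _.
have i0 : (0 < i)%N := leq_ltn_trans (leq0n _) (ltn_ord (tree_root T1)).
have j0 : (0 < #|V| - i)%N := leq_ltn_trans (leq0n _) (ltn_ord (tree_root T2)).
have iV : (i < #|V|)%N by rewrite -subn_gt0.
rewrite Ha ?Hb ?card_ord //.
by rewrite ltn_subrL i0 (leq_ltn_trans _ iV).
Qed.

Section Bernoulli.
Variable K : fieldType.

(* The coefficients of the power series t / (e^t - 1), that is, of the inverse
   of (e^t - 1) / t = \sum_n t^n / n.+1`!. *)
Fixpoint bernoulli_gf (n : nat) : seq K :=
  if n is m.+1 then
    let s := bernoulli_gf m in
    rcons s ((m == 0)%:R - \sum_(i < m) s`_i / ((m - i).+1)`!%:R)
  else [::].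

Definition bernoulli (n : nat) : K := n`!%:R * (bernoulli_gf n.+1)`_n.

Lemma size_bernoulli_gf n : size (bernoulli_gf n) = n.
Proof. by elim: n => //= n IHn; rewrite size_rcons IHn. Qed.

Lemma nth_bernoulli_gf n i :
  (i < n)%N -> (bernoulli_gf n)`_i = (bernoulli_gf i.+1)`_i.
Proof.
elim: n => // n IHn; rewrite ltnS leq_eqVlt => /predU1P[->//|lin].
by rewrite -IHn //= nth_rcons size_bernoulli_gf lin.
Qed.

(* Comparison of the coefficients of t^n in
   (\sum_k B_k / k! t^k) (e^t - 1) = t. *)
Lemma bernoulliP (K0 : [pchar K] =i pred0) n :
  \sum_(i < n.+1) (bernoulli i / i`!%:R) *
     (if (n - i == 0)%N then 0 else ((n - i)`!%:R)^-1) = (n == 1)%:R.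
Proof.
have f0 m : m`!%:R != 0 :> K.
  by rewrite ((pcharf0P K).1 K0) -lt0n fact_gt0.
have bE i : bernoulli i / i`!%:R = (bernoulli_gf i.+1)`_i.
  by rewrite /bernoulli mulrC mulKf.
case: n => [|n]; first by rewrite big_ord1 subnn mulr0.
rewrite big_ord_recr /= subnn mulr0 addr0 big_ord_recr /= subSnn /= invr1 mulr1.
rewrite !bE -[bernoulli_gf n.+1]/(rcons _ _).
rewrite nth_rcons size_bernoulli_gf ltnn eqxx eqSS addrC.
rewrite -[RHS]addr0 -addrA; congr (_ + _).
apply/eqP; rewrite addrC subr_eq0; apply/eqP.
apply: eq_bigr => i _; have iN := ltn_ord i.
by rewrite bE -(nth_bernoulli_gf iN) subSn 1?ltnW.
Qed.

(* The functional < D / (e^D - 1) | . >. *)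
Definition umbral (q : {poly K}) : K := \sum_(n < size q) q`_n * bernoulli n.

(* The equation P' = prelie (umbral P) P, P(0) = dot_tree; the coefficients
   umbral (P U) of the left factor are seen as constants of K[t]. *)
Definition is_solution (P : tree_series {poly K}) : Prop :=
  (forall (V : finType) (T : rtree V),
     (P V T)^`() = prelie (fun W U => (umbral (P W U))%:P) P T) /\
  (forall (V : finType) (T : rtree V), (P V T).[0] = (tree_iso T dot_tree)%:R).

Definition tbinom (P : tree_series {poly K}) (V : finType) (T : rtree V) :
    {poly K} :=
  #|tree_aut T|%:R *: P V T.

Definition is_indef_sum (q Q : {poly K}) : bool :=
  (Q.[0] == 0) && ((Q \Po ('X + 1)) - Q == q).

End Bernoulli.

Section Char0.
Variables (K : fieldType) (K0 : [pchar K] =i pred0).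

Lemma natr_char0 n : (n.+1%:R : K) != 0.
Proof. by rewrite ((pcharf0P K).1 K0). Qed.

Lemma natr_inj_char0 : injective (fun n => n%:R : K).
Proof.
suff H i j : (i <= j)%N -> i%:R = j%:R :> K -> i = j.
  by move=> i j /= E; have /orP[/H->|/H->] := leq_total i j.
move=> ij /eqP; rewrite eq_sym -subr_eq0 -natrB // ((pcharf0P K).1 K0) subn_eq0.
by move=> ji; apply/eqP; rewrite eqn_leq ij.
Qed.

Lemma indef_sum_exists (q : {poly K}) : exists Q, is_indef_sum q Q.
Proof.
have [n] := ubnP (size q); elim: n q => // n IHn q sq.
have [->|q0] := eqVneq q 0.
  by exists 0; rewrite /is_indef_sum horner0 comp_poly0 subr0 !eqxx.
pose m := (size q).-1.
have sqE : size q = m.+1 by rewrite /m prednK // size_poly_gt0.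
pose R := (lead_coef q / m.+1%:R) *: 'X^(m.+1).
pose d := R \Po ('X + 1) - R.
have dE : d = \sum_(i < m.+1) (lead_coef q / m.+1%:R) *: 'X^i *+ 'C(m.+1, i).
  rewrite /d /R comp_polyZ comp_Xn_poly -scalerBr exprD1n.
  rewrite big_ord_recr /= binn mulr1n addrK scaler_sumr.
  by apply: eq_bigr => i _; rewrite scalerMnr.
have dcoef j :
    d`_j = (lead_coef q / m.+1%:R) *+ 'C(m.+1, j) *+ (j < m.+1)%N.
  rewrite dE coef_sum.
  have [jm|jm] := ltnP j m.+1.
    rewrite (bigD1 (Ordinal jm)) //= big1 => [|i ij].
      by rewrite addr0 coefMn coefZ coefXn eqxx mulr1 mulr1n.
    rewrite coefMn coefZ coefXn; case: eqP => [E|]; last by rewrite mulr0 mul0rn.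
    by case/eqP: ij; apply: val_inj.
  rewrite big1 // => i _; rewrite coefMn coefZ coefXn gtn_eqF ?mulr0 ?mul0rn //.
  exact: leq_trans (ltn_ord i) jm.
have [|Q /andP[/eqP Q0 /eqP HQ]] := IHn (q - d).
  rewrite -ltnS; apply: leq_ltn_trans sq; rewrite sqE ltnS.
  apply/leq_sizeP => j mj; rewrite coefB dcoef.
  move: mj; rewrite leq_eqVlt => /predU1P[<-|mj].
    rewrite ltnSn mulr1n binSn -mulr_natr -mulrA mulVf ?natr_char0 // mulr1.
    by rewrite /lead_coef -/m subrr.
  by rewrite ltnNge mj mulr0n subr0 nth_default // sqE.
exists (Q + R); rewrite /is_indef_sum hornerD Q0 add0r hornerZ hornerXn expr0n.
rewrite mulr0 eqxx /= comp_polyD opprD addrACA HQ -/d.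
by rewrite subrK.
Qed.

Lemma poly_const (p : {poly K}) : p^`() = 0 -> p = (p`_0)%:P.
Proof.
move=> dp; apply/polyP => -[|i]; rewrite coefC //=.
have := congr1 (fun q : {poly K} => q`_i) dp.
rewrite coef_deriv coef0 -mulr_natr => /eqP.
by rewrite mulf_eq0 (negPf (natr_char0 i)) orbF => /eqP.
Qed.

Lemma indef_sum_unique (q Q R : {poly K}) :
  is_indef_sum q Q -> is_indef_sum q R -> Q = R.
Proof.
case/andP => /eqP Q0 /eqP HQ /andP[/eqP R0 /eqP HR].
apply/eqP; rewrite -subr_eq0; set S := Q - R; apply/negPn/negP => S0.
have SE : S \Po ('X + 1) = S.
  apply/eqP; rewrite -subr_eq0 /S comp_polyB.
  have -> : ((Q \Po ('X + 1)) - (R \Po ('X + 1))) - (Q - R) =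
            ((Q \Po ('X + 1)) - Q) - ((R \Po ('X + 1)) - R).
    by rewrite !opprB [R - Q]addrC addrACA [- _ + R]addrC.
  by rewrite HQ HR subrr.
have Sn n : root S n%:R.
  elim: n => [|n /eqP IHn]; apply/eqP.
    by rewrite hornerD hornerN Q0 R0 subr0.
  have -> : n.+1%:R = ('X + 1 : {poly K}).[n%:R].
    by rewrite hornerD hornerX hornerC natr1.
  by rewrite -horner_comp SE.
suff /(max_poly_roots S0) : all (root S) [seq i%:R | i <- iota 0 (size S)].
  rewrite size_map size_iota ltnn => /(_ _)/notF; apply.
  by rewrite map_inj_uniq ?iota_uniq //; apply: natr_inj_char0.
by apply/allP => _ /mapP[i _ ->].
Qed.

(* The polynomial \sum_(tau = 0)^(t - 1) q(tau). *)
Definition indef_sum (q : {poly K}) : {poly K} := xchoose (indef_sum_exists q).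

Lemma indef_sumP q : is_indef_sum q (indef_sum q).
Proof. exact: xchooseP. Qed.

Definition poly_integral (p : {poly K}) : {poly K} :=
  \poly_(i < (size p).+1) (p`_i.-1 / i%:R).

Lemma deriv_poly_integral p : (poly_integral p)^`() = p.
Proof.
apply/polyP => i; rewrite coef_deriv coef_poly ltnS.
case: ltnP => ip; last by rewrite mul0rn nth_default.
by rewrite -[RHS](divfK (natr_char0 i)) mulr_natr.
Qed.

Lemma poly_integral0 p : (poly_integral p).[0] = 0.
Proof. by rewrite horner_coef0 coef_poly /= invr0 mulr0. Qed.

Fixpoint solution_approx (n : nat) : forall V : finType, rtree V -> {poly K} :=
  if n is m.+1 then fun V T =>
    (tree_iso T dot_tree)%:R%:P +
    poly_integral (prelie (fun W U => (umbral (solution_approx m U))%:P) (solution_approx m) T)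
  else fun _ _ => 0.

Lemma solution_approxS n (V : finType) (T : rtree V) : solution_approx n.+1 T =
  (tree_iso T dot_tree)%:R%:P +
  poly_integral (prelie (fun W U => (umbral (solution_approx n U))%:P) (solution_approx n) T).
Proof. by []. Qed.

Lemma solution_approx_stable n (V : finType) (T : rtree V) :
  (#|V| <= n)%N -> solution_approx n T = solution_approx n.+1 T.
Proof.
elim: n V T => [|n IHn] V T Vn.
  by have := leq_trans (max_card (pred1 (tree_root T))) Vn; rewrite card1.
rewrite solution_approxS [RHS]solution_approxS; congr (_ + poly_integral _).
have H W (U : rtree W) : (#|W| < #|V|)%N -> solution_approx n U = solution_approx n.+1 U.
  by move=> WV; apply: IHn; rewrite -ltnS (leq_trans WV).
by apply: eq_prelie => W U WV; rewrite (H W U WV).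
Qed.

Lemma solution_approx_card n (V : finType) (T : rtree V) :
  (#|V| <= n)%N -> solution_approx n T = solution_approx #|V| T.
Proof.
elim: n => [|n IHn]; first by rewrite leqn0 => /eqP->.
rewrite leq_eqVlt => /predU1P[->//|]; rewrite ltnS => Vn.
by rewrite -solution_approx_stable // IHn.
Qed.

Lemma solution_approx_iso n (V W : finType) (T : rtree V) (U : rtree W) :
  tree_iso T U -> solution_approx n T = solution_approx n U.
Proof.
case: n => //= n TU; congr ((_%:R)%:P + poly_integral _); last exact: prelie_iso.
congr nat_of_bool; apply/idP/idP; last exact: iso_trans.
by apply: iso_trans; rewrite iso_sym.
Qed.

Lemma solution_exists : exists P : tree_series {poly K}, is_solution P.
Proof.
pose P (V : finType) (T : rtree V) := solution_approx #|V| T.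
have PE (V : finType) (T : rtree V) : P V T =
    (tree_iso T dot_tree)%:R%:P +
    poly_integral (prelie (fun W U => (umbral (P W U))%:P) P T).
  rewrite /P solution_approx_stable // solution_approxS; congr (_ + poly_integral _).
  have H W (U : rtree W) : (#|W| < #|V|)%N -> solution_approx #|V| U = P W U.
    by move=> WV; apply: solution_approx_card (ltnW WV).
  by apply: eq_prelie => W U WV; rewrite (H W U WV).
have Piso V W (T : rtree V) (U : rtree W) : tree_iso T U -> P V T = P W U.
  by move=> TU; rewrite /P (iso_card TU); apply: solution_approx_iso.
exists (TreeSeries Piso); split=> V T; rewrite -[coef _ _]/(P V T) PE.
  by rewrite derivD derivC add0r deriv_poly_integral.
by rewrite hornerD hornerC poly_integral0 addr0.
Qed.

Lemma solution_unique (P Q : tree_series {poly K}) :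
  is_solution P -> is_solution Q ->
  forall (V : finType) (T : rtree V), P V T = Q V T.
Proof.
case=> dP P0 [dQ Q0] V T.
have [n] := ubnP #|V|; elim: n V T => // n IHn V T Vn.
apply/eqP; rewrite -subr_eq0; apply/eqP.
rewrite [LHS]poly_const -?horner_coef0 ?hornerD ?hornerN ?P0 ?Q0 ?subrr //.
rewrite derivB dP dQ; apply/eqP; rewrite subr_eq0; apply/eqP.
by apply: eq_prelie => W U WV; rewrite IHn // (leq_trans WV).
Qed.

End Char0.

(* Main.v *)
(* Write b(T) for tbinom P T and S for indef_sum.  Double counting the
   isomorphisms from a grafted tree onto T turns the pre-Lie equation into a sum
   over the edges of T,
     b(T)' = \sum_c umbral (b(branch of T at c)) * b(T without that branch),
   with c ranging over the vertices other than the root.  Since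
   (S q)' = umbral q + S q', the product of the S b(branch of T at d) over the
   children d of the root satisfies the same equation: the first summand accounts
   for c = d, the second for the c strictly above d.  Both sides agree at 0, so
   they are equal by induction on the number of vertices.  All the trees occurring
   in the induction are the subtrees sub_rtree T r C of T. *)

Require Import Defs.
From mathcomp Require Import all_boot all_order all_algebra.
From mathcomp Require Import fingroup perm ring.

Set Implicit Arguments.
Unset Strict Implicit.
Unset Printing Implicit Defensive.

Import GRing.Theory.
Local Open Scope ring_scope.

(** * The umbral functional, and the derivative of an indefinite sum *)

Section IndefiniteSum.
Variables (K : fieldType) (K0 : [pchar K] =i pred0).

(** Padding with zero coefficients lets polynomials of different sizes share one summation range, as
    additivity requires. *)
Lemma umbralE (q : {poly K}) n :
  (size q <= n)%N -> umbral q = \sum_(i < n) q`_i * bernoulli K i.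
Proof.
move=> sq; rewrite /umbral (big_ord_widen _ (fun i => q`_i * bernoulli K i) sq).
rewrite [RHS](bigID (fun i : 'I_n => i < size q)%N) /= [X in _ + X]big1 ?addr0 //.
by move=> i; rewrite -leqNgt => si; rewrite nth_default ?mul0r.
Qed.

Lemma umbralD (q r : {poly K}) : umbral (q + r) = umbral q + umbral r.
Proof.
pose n := maxn (size q) (size r).
rewrite (@umbralE q n) ?leq_maxl // (@umbralE r n) ?leq_maxr //.
rewrite (@umbralE _ n) ?size_polyD // -big_split.
by apply: eq_bigr => i _; rewrite coefD mulrDl.
Qed.

Lemma umbralZ a (q : {poly K}) : umbral (a *: q) = a * umbral q.
Proof.
rewrite (@umbralE _ (size q)) ?size_scale_leq // mulr_sumr.
by apply: eq_bigr => i _; rewrite coefZ mulrA.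
Qed.

Lemma umbral0 : umbral (0 : {poly K}) = 0.
Proof. by rewrite -(scale0r 0) umbralZ mul0r. Qed.

Lemma umbralXn n : umbral ('X^n : {poly K}) = bernoulli K n.
Proof.
rewrite (@umbralE _ n.+1) ?size_polyXn // (bigD1 ord_max) //= coefXn eqxx mul1r.
rewrite big1 ?addr0 // => i ni; rewrite coefXn; case: eqP => [E|]; last by rewrite mul0r.
by case/eqP: ni; apply: val_inj.
Qed.

Lemma fact_neq0 n : n`!%:R != 0 :> K.
Proof. by rewrite ((pcharf0P K).1 K0) -lt0n fact_gt0. Qed.

(** This is [bernoulliP] multiplied by n!; the factor disappears because the right-hand side
    vanishes unless n = 1. *)
Lemma bernoulli_sum n :
  \sum_(i < n) bernoulli K i *+ 'C(n, i) = (n == 1)%:R.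
Proof.
have -> : \sum_(i < n) bernoulli K i *+ 'C(n, i) = n`!%:R * (n == 1)%:R.
  rewrite -(bernoulliP K0) big_ord_recr /= subnn mulr0 addr0 mulr_sumr.
  apply: eq_bigr => i _; have ni := ltn_ord i.
  rewrite subn_eq0 leqNgt ni /= -(bin_fact (ltnW ni)) !natrM -mulr_natr.
  have := fact_neq0 i; have := fact_neq0 (n - i).
  by set a := _%:R; set b := _%:R => a0 b0; field; rewrite a0 b0.
by case: n => [|[|n]]; rewrite ?mulr0 ?mulr1.
Qed.

(** Symbolically, D / (e^D - 1) applied to (e^D - 1) Q leaves D Q, taken at 0. By linearity it is
    enough to treat monomials, where the binomial theorem reduces the claim to [bernoulli_sum]. *)
Lemma umbral_diff (Q : {poly K}) : umbral ((Q \Po ('X + 1)) - Q) = Q^`().[0].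
Proof.
have sum_umbral n (F : 'I_n -> {poly K}) :
    umbral (\sum_i F i) = \sum_i umbral (F i).
  by exact: (big_morph _ umbralD umbral0).
rewrite -[Q]coefK poly_def rmorph_sum -sumrB raddf_sum horner_sum sum_umbral.
apply: eq_bigr => n _; rewrite /= comp_polyZ -scalerBr umbralZ derivZ hornerZ.
congr (_ * _); rewrite comp_Xn_poly exprD1n big_ord_recr /= binn addrK.
rewrite sum_umbral derivXn hornerMn hornerXn expr0n.
transitivity (\sum_(i < n) bernoulli K i *+ 'C(n, i)).
  by apply: eq_bigr => i _; rewrite -scaler_nat umbralZ umbralXn mulr_natl.
by rewrite bernoulli_sum; case: (val n) => [|[|m]]; rewrite ?mul0rn.
Qed.

Lemma indef_sumE q Q : is_indef_sum q Q -> indef_sum K0 q = Q.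
Proof. exact: indef_sum_unique (indef_sumP K0 q). Qed.

Lemma indef_sumD p q :
  indef_sum K0 (p + q) = indef_sum K0 p + indef_sum K0 q.
Proof.
apply: indef_sumE; have /andP[/eqP p0 /eqP Hp] := indef_sumP K0 p.
have /andP[/eqP q0 /eqP Hq] := indef_sumP K0 q.
by rewrite /is_indef_sum hornerD p0 q0 addr0 comp_polyD opprD addrACA Hp Hq !eqxx.
Qed.

Lemma indef_sumC a q : indef_sum K0 (a%:P * q) = a%:P * indef_sum K0 q.
Proof.
apply: indef_sumE; have /andP[/eqP q0 /eqP Hq] := indef_sumP K0 q.
by rewrite /is_indef_sum hornerM q0 mulr0 comp_polyM comp_polyC -mulrBr Hq !eqxx.
Qed.

Lemma indef_sum_sum (I : finType) (R : pred I) (F : I -> {poly K}) :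
  indef_sum K0 (\sum_(i | R i) F i) = \sum_(i | R i) indef_sum K0 (F i).
Proof.
apply: (big_morph _ indef_sumD).
by have := indef_sumC 0 0; rewrite polyC0 !mul0r.
Qed.

Lemma indef_sum0 q : (indef_sum K0 q).[0] = 0.
Proof. by have /andP[/eqP] := indef_sumP K0 q. Qed.

(* Differentiation commutes with differences, so both sides have difference q';
   their values at 0 agree because D is D / (e^D - 1) applied to e^D - 1. *)
Lemma deriv_indef_sum q :
  (indef_sum K0 q)^`() = (umbral q)%:P + indef_sum K0 q^`().
Proof.
apply/eqP; rewrite addrC -subr_eq; apply/eqP/esym/indef_sumE.
have /andP[_ /eqP Hq] := indef_sumP K0 q.
rewrite /is_indef_sum hornerD hornerN hornerC -[in umbral q]Hq umbral_diff subrr eqxx /=.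
rewrite comp_polyB comp_polyC -[in eqbRHS]Hq derivB deriv_comp derivD derivX derivC.
by rewrite addr0 mulr1 opprB addrA subrK.
Qed.

End IndefiniteSum.

(** * Induction from the root, and subtrees cut out of a rooted tree *)

Lemma rtree_ind (V : finType) (T : rtree V) (Q : V -> Prop) :
  Q (tree_root T) ->
  (forall v, v != tree_root T -> Q (parent T v) -> Q v) -> forall v, Q v.
Proof.
move=> Q0 QS v; have [n] := iter_parent T v.
elim: n v => [v /= ->//|n IHn v]; rewrite iterSr => /IHn.
by have [->|vr] := eqVneq v (tree_root T); [|exact: QS].
Qed.

(** Otherwise v and w would lie on a cycle of the parent map. Running around it at least as many
    times as v is far from the root ends at the root, which forces both vertices to be the root. *)
Lemma parent_antisym (V : finType) (T : rtree V) m n v w :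
  iter m (parent T) v = w -> iter n (parent T) w = v -> v = w.
Proof.
move=> vw wv; have [k kv] := iter_parent T v.
have iter_root j : iter j (parent T) (tree_root T) = tree_root T.
  by elim: j => //= j ->; rewrite parent_root.
have cycle j : iter (j * (n + m)) (parent T) v = v.
  by elim: j => // j IHj; rewrite mulSn iterD IHj iterD vw wv.
case: m vw cycle => [//|m] <- /(_ k).
by rewrite addnS mulnS addnC iterD kv iter_root => <-; rewrite iter_root.
Qed.

Section Subtree.
Variables (V : finType) (T : rtree V).
Implicit Types (r c d x : V) (C : {set V}).

(** Fixing r and the elements of C stops upward paths there, so a path reaches r only if it meets no
    element of C before. On the resulting subtree this map is itself a parent map with root r. *)
Definition cut_parent r C x := if (x == r) || (x \in C) then x else parent T x.

(* The vertices of the tree obtained from the branch of T at r by removing the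
   branches at the elements of C other than r. *)
Definition subtree r C := [set x | fconnect (cut_parent r C) x r].

Lemma cut_parent_root r C : cut_parent r C r = r.
Proof. by rewrite /cut_parent eqxx. Qed.

Lemma subtree_root r C : r \in subtree r C.
Proof. by rewrite inE connect0. Qed.

Lemma cut_parent_fixed r C x :
  x \in subtree r C -> cut_parent r C x = x -> x = r.
Proof.
rewrite inE => /iter_findex + fx.
by elim: (findex _ _ _) => [//|n IHn]; rewrite iterSr fx.
Qed.

(** This recursion along the parent map, combined with [rtree_ind], replaces explicit reasoning
    about paths in what follows. *)
Lemma in_subtree r C x :
  x != r -> (x \in subtree r C) = (x \notin C) && (parent T x \in subtree r C).
Proof.
move=> xr; apply/idP/andP => [xD|[xC]].
  have xC : x \notin C.
    apply: contra xr => xC; apply/eqP/(cut_parent_fixed xD).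
    by rewrite /cut_parent xC orbT.
  split=> //; move: xD; rewrite !inE => /iter_findex.
  case: (findex _ _ _) => [/eqP|n]; first by rewrite (negPf xr).
  rewrite iterSr [cut_parent r C x]/cut_parent (negPf xr) (negPf xC) /= => E.
  by rewrite -[X in fconnect _ _ X]E fconnect_iter.
rewrite !inE; apply: connect_trans; apply: connect1.
by rewrite /= /cut_parent (negPf xr) (negPf xC).
Qed.

Lemma cut_parentE r C x :
  x \in subtree r C -> x != r -> cut_parent r C x = parent T x.
Proof.
by move=> xD xr; move: xD; rewrite in_subtree // /cut_parent (negPf xr) => /andP[/negPf->].
Qed.

Lemma subtree_parent r C x : x \in subtree r C -> cut_parent r C x \in subtree r C.
Proof.
have [->|xr] := eqVneq x r; first by rewrite cut_parent_root.
by move=> xD; rewrite cut_parentE //; move: xD; rewrite in_subtree // => /andP[].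
Qed.

Lemma root_in_subtree r C : tree_root T \in subtree r C -> r = tree_root T.
Proof.
move=> /cut_parent_fixed-> //.
by rewrite /cut_parent; case: ifP; rewrite ?parent_root.
Qed.

Lemma subtree_iter r C x : x \in subtree r C -> exists n, iter n (parent T) x = r.
Proof.
elim/(@rtree_ind _ T): x => [/root_in_subtree->|x _ IHx]; first by exists 0%N.
have [->|xr] := eqVneq x r; first by exists 0%N.
by rewrite in_subtree // => /andP[_ /IHx[n <-]]; exists n.+1; rewrite iterSr.
Qed.

Lemma subtree_antisym r C c D : c \in subtree r C -> r \in subtree c D -> c = r.
Proof. by move=> /subtree_iter[m Hm] /subtree_iter[n]; apply: parent_antisym Hm. Qed.

Lemma subtree_trans r C c x :
  c \in subtree r C -> x \in subtree c C -> x \in subtree r C.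
Proof.
move=> cD; elim/(@rtree_ind _ T): x => [/root_in_subtree<-//|x _ IHx].
have [->//|xc] := eqVneq x c; rewrite in_subtree // => /andP[xC /IHx pxD].
by have [->|xr] := eqVneq x r; rewrite ?subtree_root // in_subtree // xC.
Qed.

(** Both sides obey the same recursion along the parent map, except at c, where both are false: c is
    a new cut on the left and the root of the removed branch on the right. *)
Lemma subtree_cut r C c x : c \in subtree r C -> c != r ->
  (x \in subtree r (c |: C)) = (x \in subtree r C) && (x \notin subtree c C).
Proof.
move=> cD cr; elim/(@rtree_ind _ T): x => [|x _ IHx].
  have [->|rr] := eqVneq r (tree_root T).
    rewrite !subtree_root; apply/esym/negP => /root_in_subtree ctr.
    move: cD; rewrite ctr => /root_in_subtree E; by rewrite ctr E eqxx in cr.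
  by apply/idP/andP => [|[]] /root_in_subtree E; rewrite E eqxx in rr.
have [->|xr] := eqVneq x r.
  rewrite !subtree_root; apply/esym/negP => /(subtree_antisym cD) E.
  by rewrite E eqxx in cr.
rewrite !(in_subtree _ xr) IHx in_setU1 negb_or.
have [->|xc] := eqVneq x c; first by rewrite subtree_root andbF.
by rewrite (in_subtree _ xc) negb_and negbK; case: (x \in C).
Qed.

(** Upward paths that reach r stay inside the subtree, so they never meet c. *)
Lemma subtree_setU1 r C c : c \notin subtree r C -> subtree r (c |: C) = subtree r C.
Proof.
move=> cD; apply/setP; elim/(@rtree_ind _ T) => [|x _ IHx].
  by apply/idP/idP => /root_in_subtree->; rewrite subtree_root.
have [->|xr] := eqVneq x r; first by rewrite !subtree_root.
rewrite !(in_subtree _ xr) in_setU1 negb_or IHx.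
have [xc|//] := eqVneq x c.
by rewrite -(in_subtree _ xr) xc (negPf cD).
Qed.

End Subtree.

(** * Counting isomorphisms onto subtrees *)

Section Embeddings.
Variables (V : finType) (T : rtree V).
Implicit Types (r c d x : V) (C : {set V}).

Lemma sub_rtree_subproof r C :
  is_rtree (exist _ r (subtree_root T r C) : {x | x \in subtree T r C},
    [ffun x => exist _ (cut_parent T r C (val x)) (subtree_parent (valP x))]).
Proof.
apply: is_rtreeI => [|x]; first by apply: val_inj; rewrite /= cut_parent_root.
have := valP x; rewrite inE => /iter_findex xr.
exists (findex (cut_parent T r C) (val x) r).
apply: val_inj => /=; rewrite -[RHS]xr.
by elim: (findex _ _ _) => //= n ->.
Qed.

Definition sub_rtree r C : rtree {x | x \in subtree T r C} :=
  RTree (sub_rtree_subproof r C).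

(* The isomorphisms from U onto sub_rtree T r C, as functions into V. *)
Definition embeddings (W : finType) (U : rtree W) r C : {set {ffun W -> V}} :=
  [set f : {ffun W -> V} | [&& injectiveb f,
     [forall x, (x \in codom f) == (x \in subtree T r C)] &
     [forall w, f (parent U w) == cut_parent T r C (f w)]]].

Lemma embeddingsP (W : finType) (U : rtree W) r C (f : {ffun W -> V}) :
  reflect [/\ injective f, forall x, (x \in codom f) = (x \in subtree T r C) &
             forall w, f (parent U w) = cut_parent T r C (f w)]
          (f \in embeddings U r C).
Proof.
rewrite inE; apply: (iffP and3P) => -[].
  by move=> /injectiveP If /forallP Df /forallP pf; split=> // x; apply/eqP.
by move=> If Df pf; split; [apply/injectiveP | apply/forallP=> x; apply/eqP..].
Qed.

Lemma embedding_in (W : finType) (U : rtree W) r C (f : {ffun W -> V}) w :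
  f \in embeddings U r C -> f w \in subtree T r C.
Proof. by case/embeddingsP => _ <- _; apply: codom_f. Qed.

Lemma embedding_root (W : finType) (U : rtree W) r C (f : {ffun W -> V}) :
  f \in embeddings U r C -> f (tree_root U) = r.
Proof.
move=> fe; apply: (cut_parent_fixed (embedding_in _ fe)).
by case/embeddingsP: fe => _ _ <-; rewrite parent_root.
Qed.

Lemma embedding_parent (W : finType) (U : rtree W) r C (f : {ffun W -> V}) w :
  f \in embeddings U r C -> w != tree_root U -> f (parent U w) = parent T (f w).
Proof.
move=> fe wr; have [fI _ ->] := embeddingsP _ _ _ _ fe.
by rewrite cut_parentE ?(embedding_in _ fe) // -(embedding_root fe) (inj_eq fI).
Qed.

Lemma sub_rtreeP (W : finType) (U : rtree W) r C :
  reflect (exists f, f \in embeddings U r C) (tree_iso U (sub_rtree r C)).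
Proof.
apply: (iffP (isoP _ _)) => [[f bf pf]|[f fe]].
  exists [ffun w => val (f w)]; apply/embeddingsP; split.
  - by move=> v w; rewrite !ffunE => /val_inj/(bij_inj bf).
  - have [g fK gK] := bf; move=> x; apply/codomP/idP => [[w ->]|xD].
      by rewrite ffunE (valP (f w)).
    by exists (g (exist _ x xD)); rewrite ffunE gK.
  - by move=> w; rewrite !ffunE pf /parent /= ffunE.
have [fI fD fp] := embeddingsP _ _ _ _ fe.
exists (fun w => exist _ (f w) (embedding_in w fe)).
  apply: inj_card_bij => [v w /(congr1 val)/fI//|].
  by rewrite card_sig -(card_codom fI) (eq_card fD).
by move=> w; apply: val_inj; rewrite /parent /= ffunE fp.
Qed.

(** If one embedding [f0] exists, precomposing it with the automorphisms of U yields each embedding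
    exactly once. *)
Lemma card_embeddings (W : finType) (U : rtree W) r C :
  #|embeddings U r C| = (#|tree_aut U| * tree_iso U (sub_rtree r C))%N.
Proof.
case: sub_rtreeP => [[f0 f0e]|noe]; last first.
  rewrite muln0; apply: eq_card0 => f; apply/negP => fe; apply: noe.
  by exists f.
have [f0I f0D f0p] := embeddingsP _ _ _ _ f0e.
rewrite muln1 -(@card_in_imset _ _ (fun s : {perm W} => [ffun w => f0 (s w)])).
  apply: eq_card => f; apply/idP/imsetP => [fe|[s]].
    have [fI fD fp] := embeddingsP _ _ _ _ fe.
    have fP w : f w \in codom f0 by rewrite f0D (embedding_in _ fe).
    have sI : injective (fun w => iinv (fP w)).
      by move=> v w /(congr1 f0); rewrite !f_iinv => /fI.
    exists (perm sI); last by apply/ffunP => w; rewrite ffunE permE f_iinv.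
    rewrite inE; apply/forallP => w; apply/eqP/f0I.
    by rewrite !permE f0p !f_iinv fp.
  rewrite inE => /forallP sp ->; apply/embeddingsP; split.
  - by move=> v w; rewrite !ffunE => /f0I/perm_inj.
  - move=> x; rewrite -f0D; apply/codomP/codomP => -[w ->].
      by exists (s w); rewrite ffunE.
    by exists (s^-1%g w); rewrite ffunE permKV.
  - by move=> w; rewrite !ffunE (eqP (sp w)) f0p.
move=> s t _ _ /ffunP st; apply/permP => w; apply: f0I.
by have := st w; rewrite !ffunE.
Qed.

(** Conjugation by an isomorphism maps automorphisms injectively to automorphisms; by symmetry the
    resulting inequality is an equality. *)
Lemma card_tree_aut_iso (W : finType) (U : rtree W) :
  tree_iso T U -> #|tree_aut T| = #|tree_aut U|.
Proof.
move: T; suff H (X Y : finType) (S : rtree X) (R : rtree Y) :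
    tree_iso S R -> (#|tree_aut S| <= #|tree_aut R|)%N.
  by move=> S SU; apply/eqP; rewrite eqn_leq !H // iso_sym.
case/isoP => f [g fK gK] fp.
have gp y : g (parent R y) = parent S (g y) by apply: (can_inj fK); rewrite fp !gK.
have sI (s : {perm X}) : injective (fun y => f (s (g y))).
  by move=> y z /(can_inj fK)/perm_inj/(can_inj gK).
rewrite -(@card_in_imset _ _ (fun s => perm (sI s))) => [|s t _ _ /permP st].
  apply/subset_leq_card/subsetP => _ /imsetP[s + ->]; rewrite !inE.
  move/forallP => sp; apply/forallP => y.
  by rewrite !permE gp (eqP (sp _)) fp.
apply/permP => x; apply: (can_inj fK).
by have := st (f x); rewrite !permE fK.
Qed.

(** An embedding of a grafted tree restricts to an embedding of [U1] onto the branch at some c and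
    one of [U2] onto what is left after cutting at c. Conversely, two such embeddings glue together,
    and the grafting vertex is forced: it is sent to the parent of c. *)
Lemma card_graft_embeddings (W1 W2 : finType) (U1 : rtree W1) (U2 : rtree W2) r C :
  (\sum_v #|embeddings (graft U1 v U2) r C| =
   \sum_(c in subtree T r C | c != r)
     #|embeddings U1 c C| * #|embeddings U2 r (c |: C)|)%N.
Proof.
pose E v := embeddings (graft U1 v U2) r C.
pose X := [set u : W2 * {ffun W1 + W2 -> V} | u.2 \in E u.1].
have inX u : (u \in X) = (u.2 \in E u.1) by rewrite in_set.
pose c0 (u : W2 * {ffun W1 + W2 -> V}) := u.2 (inl (tree_root U1)).
have -> : (\sum_v #|E v| = \sum_(u in X) 1)%N.
  under eq_bigr do rewrite -sum1_card.
  by rewrite pair_big_dep; apply: eq_bigl => u; rewrite inX.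
(* The pairs (v, f) are sorted by the image c of the root of [U1]. It differs from r because f is
   injective and already sends the root of the graft, that of [U2], to r. *)
rewrite (partition_big c0 (fun c => (c \in subtree T r C) && (c != r))) /=; last first.
  move=> [v f]; rewrite inX /c0 /= => fe; rewrite (embedding_in _ fe).
  have [fI _ _] := embeddingsP _ _ _ _ fe.
  by rewrite -(embedding_root fe) (inj_eq fI).
apply: eq_bigr => c /andP[cD cr]; rewrite -cardsX.
have inXc u : (u \in [set u | (u \in X) && (c0 u == c)]) =
    (u.2 \in E u.1) && (u.2 (inl (tree_root U1)) == c).
  by rewrite in_set inX.
pose split (u : W2 * {ffun W1 + W2 -> V}) :=
  ([ffun w => u.2 (inl w)], [ffun w => u.2 (inr w)]).
have cutE := subtree_cut _ cD cr.
rewrite sum1dep_card -(@card_in_imset _ _ split); last first.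
  move=> [v f] [w g]; rewrite !inXc /=.
  move=> /andP[fe /eqP fc] /andP[ge /eqP gc] [] /ffunP E1 /ffunP E2.
  have fg : f = g.
    by apply/ffunP => -[x|x]; [have := E1 x | have := E2 x]; rewrite !ffunE.
  (* The grafting vertices agree as well, since f sends both to the parent of the image of the root
     of [U1]. *)
  have [fI _ _] := embeddingsP _ _ _ _ fe; congr pair; rewrite // -fg in ge *.
  have := embedding_parent fe (isT : inl (tree_root U1) != tree_root (graft U1 v U2)).
  rewrite -(embedding_parent ge (isT : inl (tree_root U1) != tree_root (graft U1 w U2))).
  by rewrite /parent /= !ffunE /= eqxx => /fI[].
apply: eq_card => -[g h]; rewrite in_setX; apply/imsetP/andP => /=.
  (* Induction from the roots places the image of [U1] in the branch at c and that of [U2] in the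
     rest. As f covers the whole subtree and these two parts are disjoint, each restriction is onto
     its part. *)
  move=> [[v f]]; rewrite inXc /= => /andP[fe /eqP fc] [-> ->].
  have [fI fD fp] := embeddingsP _ _ _ _ fe.
  have fpl w : w != tree_root U1 -> f (inl (parent U1 w)) = parent T (f (inl w)).
    move=> wr; rewrite -(embedding_parent fe) //.
    by rewrite [in RHS]/parent /= ffunE /= (negPf wr).
  have flE w : w != tree_root U1 -> f (inl w) != c.
    by move=> wr; rewrite -fc (inj_eq fI).
  have fpr w : f (inr (parent U2 w)) = cut_parent T r C (f (inr w)).
    by rewrite -fp [in RHS]/parent /= ffunE.
  have flD w : f (inl w) \in subtree T c C.
    elim/(@rtree_ind _ U1): w => [|w wr IHw]; first by rewrite fc subtree_root.
    rewrite in_subtree ?flE // -fpl // IHw andbT.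
    have := embedding_in (inl w) fe; rewrite in_subtree; first by case/andP.
    by rewrite -(embedding_root fe) (inj_eq fI).
  have frD w : f (inr w) \in subtree T r (c |: C).
    elim/(@rtree_ind _ U2): w => [|w wr IHw].
      by rewrite -[inr _]/(tree_root (graft U1 v U2)) (embedding_root fe) subtree_root.
    have wr' : f (inr w) != r.
      by rewrite -(embedding_root fe) (inj_eq fI).
    rewrite in_subtree // in_setU1 negb_or -fc (inj_eq fI) /=.
    have := embedding_in (inr w) fe; rewrite in_subtree // => /andP[-> _].
    by rewrite fc -(cut_parentE (embedding_in (inr w) fe)) // -fpr IHw.
  split; apply/embeddingsP; split.
  - by move=> w x; rewrite !ffunE => /fI[].
  - move=> x; apply/codomP/idP => [[w ->]|xD]; first by rewrite ffunE flD.
    have := subtree_trans cD xD; rewrite -fD => /codomP[[w|w] xE].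
      by exists w; rewrite ffunE.
    by have := frD w; rewrite cutE -xE xD andbF.
  - move=> w; rewrite !ffunE.
    have [->|wr] := eqVneq w (tree_root U1).
      by rewrite parent_root fc cut_parent_root.
    by rewrite cut_parentE ?flE // fpl.
  - by move=> w x; rewrite !ffunE => /fI[].
  - move=> x; apply/codomP/idP => [[w ->]|xD]; first by rewrite ffunE frD.
    move: (xD); rewrite cutE -fD => /andP[/codomP[[w|w] xE] xc].
      by rewrite xE flD in xc.
    by exists w; rewrite ffunE.
  - move=> w; rewrite !ffunE fpr.
    have [->|wr] := eqVneq (f (inr w)) r; first by rewrite !cut_parent_root.
    by rewrite !cut_parentE ?(embedding_in _ fe).
move=> [ge he].
have [gI gD gp] := embeddingsP _ _ _ _ ge.
have [hI hD hp] := embeddingsP _ _ _ _ he.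
(* The parent of c survives the cut: if it were in the branch at c, then c would be the root of T
   and hence equal to r. Its preimage under h is the vertex on which to graft. *)
have : parent T c \in codom h.
  rewrite hD cutE; move: (cD); rewrite in_subtree // => /andP[cC ->] /=.
  apply: contra cr => /subtree_iter[n pn]; apply/eqP.
  have cp : c = parent T c := @parent_antisym _ T 1 n _ _ erefl pn.
  have cT := parent_fixed (esym cp).
  by move: cD; rewrite cT => /root_in_subtree->.
case/codomP => v hv.
pose f : {ffun W1 + W2 -> V} := [ffun x => match x with inl w => g w | inr w => h w end].
exists (v, f); last by congr pair; apply/ffunP => w; rewrite !ffunE.
have gDr w : g w \in subtree T r C := subtree_trans cD (embedding_in w ge).
have hDr w : (h w \in subtree T r C) && (h w \notin subtree T c C).
  by rewrite -cutE (embedding_in _ he).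
rewrite inXc /= ffunE (embedding_root ge) eqxx andbT.
apply/embeddingsP; split.
- move=> [w|w] [x|x]; rewrite !ffunE.
  + by move/gI->.
  + by move=> gh; have := hDr x; rewrite -gh (embedding_in _ ge) andbF.
  + by move=> gh; have := hDr w; rewrite gh (embedding_in _ ge) andbF.
  + by move/hI->.
- move=> x; apply/codomP/idP => [[[w|w] ->]|xD]; rewrite ?ffunE //.
    by case/andP: (hDr w).
  case xc: (x \in subtree T c C).
    by move: xc; rewrite -gD => /codomP[w ->]; exists (inl w); rewrite ffunE.
  have : x \in codom h by rewrite hD cutE xD xc.
  by case/codomP=> w ->; exists (inr w); rewrite ffunE.
- move=> [w|w]; rewrite [in LHS]/parent /= !ffunE /=.
    have gwr : g w != r.
      apply: contraNneq cr => gr.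
      by have := embedding_in w ge; rewrite gr => /(subtree_antisym cD)->.
    have [->|wr] := eqVneq w (tree_root U1).
      by rewrite -hv (embedding_root ge) cut_parentE.
    by rewrite (embedding_parent ge) // cut_parentE.
  rewrite hp; have [->|hr] := eqVneq (h w) r; first by rewrite !cut_parent_root.
  by rewrite !cut_parentE ?(embedding_in _ he) //; case/andP: (hDr w).
Qed.

End Embeddings.

(** * Leibniz rule, and sums over representatives of isomorphism classes *)

Lemma deriv_prod (R : comNzRingType) (I : finType) (Q : pred I) (F : I -> {poly R}) :
  (\prod_(i | Q i) F i)^`() =
  \sum_(i | Q i) (F i)^`() * \prod_(j | Q j && (j != i)) F j.
Proof.
(* The induction runs over a list without duplicates, so that the condition j != i removes only the
   differentiated factor. *)
elim: (index_enum I) (index_enum_uniq I) => [|a s IHs] /=.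
  by rewrite !big_nil derivC.
move=> /andP[as_ /IHs{}IHs]; rewrite !big_cons /= eqxx andbF.
have asE : \prod_(j <- s | Q j && (j != a)) F j = \prod_(j <- s | Q j) F j.
  rewrite big_seq_cond [RHS]big_seq_cond; apply: eq_bigl => j.
  by have [js|//] := boolP (j \in s); rewrite (memPn as_) ?andbT.
have sE : \sum_(i <- s | Q i) (F i)^`() * \prod_(j <- a :: s | Q j && (j != i)) F j
    = (if Q a then F a else 1) * (\prod_(i <- s | Q i) F i)^`().
  rewrite IHs mulr_sumr [LHS]big_seq_cond [RHS]big_seq_cond.
  apply: eq_bigr => i /andP[is_ _]; rewrite big_cons.
  have -> : a != i by apply: contraNneq as_ => ->.
  by rewrite andbT; case: ifP; rewrite ?mul1r // mulrCA.
by rewrite asE sE; case: ifP => _; rewrite ?mul1r // derivM.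
Qed.

Lemma sum_reps_iso n (V : finType) (T : rtree V) :
  (\sum_(U in reps n) tree_iso U T = (#|V| == n))%N.
Proof.
have [Vn|Vn] := eqVneq #|V| n; last first.
  rewrite big1 // => U _; apply/eqP; rewrite eqb0; apply: contra Vn => /iso_card <-.
  by rewrite card_ord.
have [U rU UT] := reps_iso T Vn.
rewrite (bigD1 U) //= UT big1 // => S /andP[rS SU].
apply/eqP; rewrite eqb0; apply: contra SU => ST; apply/eqP/reps_inj => //.
by apply: iso_trans ST _; rewrite iso_sym.
Qed.

(** This writes 1 as a sum with the index set of [prelie], so that an expression in two given trees
    can be compared term by term with a pre-Lie coefficient. *)
Lemma sum_reps_pair n (V W : finType) (T : rtree V) (U : rtree W) :
  (#|V| + #|W| = n ->
   \sum_(i < n.+1) \sum_(S in reps i) \sum_(R in reps (n - i))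
     tree_iso S T * tree_iso R U = 1)%N.
Proof.
move=> VWn; under eq_bigr => i _ do under eq_bigr => S _ do
  rewrite -big_distrr /= sum_reps_iso.
under eq_bigr => i _ do rewrite -big_distrl /= sum_reps_iso.
have Vn : (#|V| < n.+1)%N by rewrite ltnS -VWn leq_addr.
have nV : (n - #|V|)%N = #|W| by rewrite -VWn addKn.
rewrite (bigD1 (Ordinal Vn)) //= nV !eqxx big1 // => i ni.
by case: eqP => // E; case/eqP: ni; apply: val_inj; rewrite /= E.
Qed.

(** * The differential equation and the product formula for subtrees *)

Section Solution.
Variables (K : fieldType) (K0 : [pchar K] =i pred0).
Variables (P : tree_series {poly K}) (solP : is_solution P).

Lemma tbinom_iso (V W : finType) (T : rtree V) (U : rtree W) :
  tree_iso T U -> tbinom P T = tbinom P U.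
Proof. by move=> TU; rewrite /tbinom (card_tree_aut_iso TU) (coef_iso P TU). Qed.

Section Cut.
Variables (V : finType) (T : rtree V).
Implicit Types (r c d e : V) (C D : {set V}).

(** Both sides count pairs of a grafting vertex v and an embedding of the graft onto the subtree:
    each v that gives an isomorphic graft admits as many embeddings as the subtree has
    automorphisms. *)
Lemma card_graft_iso (W1 W2 : finType) (U1 : rtree W1) (U2 : rtree W2) r C :
  (#|[set v | tree_iso (graft U1 v U2) (sub_rtree T r C)]| *
     #|tree_aut (sub_rtree T r C)| =
   \sum_(c in subtree T r C | c != r)
     #|tree_aut U1| * #|tree_aut U2| *
     (tree_iso U1 (sub_rtree T c C) * tree_iso U2 (sub_rtree T r (c |: C))))%N.
Proof.
rewrite -sum1dep_card big_distrl big_mkcond /=.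
under [RHS]eq_bigr => c _ do rewrite mulnACA -!card_embeddings.
rewrite -card_graft_embeddings; apply: eq_bigr => v _; rewrite card_embeddings.
by case: ifP => [/card_tree_aut_iso->|_]; rewrite ?mul1n ?muln1 ?muln0.
Qed.

Lemma card_subtree_cut r C c : c \in subtree T r C -> c != r ->
  (#|subtree T c C| + #|subtree T r (c |: C)| = #|subtree T r C|)%N.
Proof.
move=> cD cr; rewrite -(cardsID (subtree T c C) (subtree T r C)).
congr (_ + _)%N; apply: eq_card => x; rewrite !inE.
  have := @subtree_trans _ T r C c x cD; rewrite !inE => H.
  by apply/idP/andP => [xD|[]//]; rewrite H.
by have := subtree_cut x cD cr; rewrite !inE andbC.
Qed.

Lemma deriv_tbinom_sub r C :
  (tbinom P (sub_rtree T r C))^`() =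
  \sum_(c in subtree T r C | c != r)
    (umbral (tbinom P (sub_rtree T c C)))%:P * tbinom P (sub_rtree T r (c |: C)).
Proof.
have [dP _] := solP; rewrite {1}/tbinom derivZ dP /prelie scaler_sumr.
(* The double counting is carried out inside the three sums of [prelie], after which the sum over c
   is moved to the outside. *)
under eq_bigr => i _ do (rewrite scaler_sumr; under eq_bigr => T1 _ do
  (rewrite scaler_sumr; under eq_bigr => T2 _ do
   (rewrite scaler_nat -mulrnA card_graft_iso -sumrMnr);
   rewrite exchange_big /=); rewrite exchange_big /=).
rewrite exchange_big /=; apply: eq_bigr => c /andP[cD cr].
set G := (X in _ = X).
have cardE : (#|{: {x | x \in subtree T c C}}| + #|{: {x | x \in subtree T r (c |: C)}}|
    = #|{: {x | x \in subtree T r C}}|)%N.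
  by rewrite !card_sig; apply: card_subtree_cut.
(* For fixed c, exactly one choice of i, [T1] and [T2] represents the two pieces of the subtree. Its
   automorphism counts turn the coefficients of P into the two binomials. *)
rewrite -[RHS]mulr1n -(sum_reps_pair (sub_rtree T c C) (sub_rtree T r (c |: C)) cardE).
rewrite -sumrMnr; apply: eq_bigr => i _; rewrite -sumrMnr; apply: eq_bigr => T1 _.
rewrite -sumrMnr; apply: eq_bigr => T2 _; rewrite mulrnA.
case T1c: (tree_iso T1 _); last by rewrite mul0n.
case T2c: (tree_iso T2 _); last by rewrite muln0.
congr (_ *+ _); rewrite /G -(tbinom_iso T1c) -(tbinom_iso T2c) /tbinom umbralZ.
by rewrite -mul_polyC polyCM !rmorph_nat mulrACA -natrM mulr_natl.
Qed.

(** The condition d != r matters when r is the root of T, which is its own parent. *)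
Definition child r C d := [&& parent T d == r, d != r & d \notin C].

Lemma child_in_subtree r C d : child r C d -> d \in subtree T r C.
Proof. by case/and3P => /eqP pd dr dC; rewrite in_subtree // dC pd subtree_root. Qed.

Lemma child_notin_subtree r C d D : child r C d -> r \notin subtree T d D.
Proof.
move=> dr; apply/negP => /(subtree_antisym (child_in_subtree dr)) E.
by case/and3P: dr => _; rewrite E eqxx.
Qed.

Lemma subtree_child r C c : c \in subtree T r C -> c != r ->
  exists2 d, child r C d & c \in subtree T d C.
Proof.
elim/(@rtree_ind _ T): c => [/root_in_subtree->|c _ IHc cD cr]; first by rewrite eqxx.
move: (cD); rewrite in_subtree // => /andP[cC pD].
have [pr|pr] := eqVneq (parent T c) r.
  by exists c; rewrite ?subtree_root // /child pr eqxx cr.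
have [d dr dD] := IHc pD pr; exists d => //.
by have [->|cd] := eqVneq c d; rewrite ?subtree_root // in_subtree // cC.
Qed.

(** Climbing from c reduces to the case where c is d or e. One child would then lie in the branch at
    the other, which would force r, its parent, into that branch. *)
Lemma child_unique r C c d e :
  child r C d -> child r C e -> c \in subtree T d C -> c \in subtree T e C -> d = e.
Proof.
move=> dr er; elim/(@rtree_ind _ T): c => [/root_in_subtree-> /root_in_subtree->//|c _ IHc].
have nested x y : child r C x -> child r C y -> x \in subtree T y C -> x = y.
  move=> xr yr; have [//|xy] := eqVneq x y; rewrite in_subtree // => /andP[_].
  by case/and3P: xr => /eqP-> _ _; rewrite (negPf (child_notin_subtree _ yr)).
have [->|cd] := eqVneq c d; first by move=> _; apply: nested.
have [->|ce] := eqVneq c e; first by move=> + _ => /nested-> //.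
by rewrite (in_subtree _ _ cd) (in_subtree _ _ ce) => /andP[_ pd] /andP[_ pe]; apply: IHc.
Qed.

(** The branches at the children of r partition the other vertices: [subtree_child] gives the
    covering and [child_unique] the disjointness. *)
Lemma sum_subtree (R : nmodType) (F : V -> R) r C :
  \sum_(c in subtree T r C | c != r) F c =
  \sum_(d | child r C d) \sum_(c in subtree T d C) F c.
Proof.
rewrite [RHS](exchange_big_dep (fun c => (c \in subtree T r C) && (c != r))) /=.
  apply: eq_bigr => c /andP[cD cr]; have [d dr dD] := subtree_child cD cr.
  rewrite (big_pred1 d) // => e /=; apply/andP/eqP => [[er eD]|->//].
  exact: child_unique er dr eD dD.
move=> d c dr cD; rewrite (subtree_trans (child_in_subtree dr) cD).
by apply: contraTneq cD => ->; apply: child_notin_subtree dr.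
Qed.

(** The vertex sets coincide by [subtree_setU1], but the trees live on different sigma types, so the
    equality is obtained through an isomorphism. *)
Lemma sub_rtree_setU1 r C c :
  c \notin subtree T r C -> tbinom P (sub_rtree T r (c |: C)) = tbinom P (sub_rtree T r C).
Proof.
move=> cD; apply: tbinom_iso; apply/sub_rtreeP.
have [f fe] : exists f, f \in embeddings T (sub_rtree T r (c |: C)) r (c |: C).
  by apply/sub_rtreeP/iso_refl.
exists f; have [fI fD fp] := embeddingsP _ _ _ _ _ fe.
apply/embeddingsP; split=> // [x|w]; first by rewrite fD subtree_setU1.
have fw := embedding_in w fe; rewrite fp.
have [->|wr] := eqVneq (f w) r; first by rewrite !cut_parent_root.
by rewrite !cut_parentE //; have /setP <- := subtree_setU1 cD.
Qed.

(** The initial condition selects the one-vertex tree, that is, the case where r has no child left;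
    its automorphism group is trivial. *)
Lemma tbinom_sub_horner0 r C :
  (tbinom P (sub_rtree T r C)).[0] = [forall d, ~~ child r C d]%:R.
Proof.
have [_ P0] := solP; rewrite /tbinom hornerZ P0; set S := sub_rtree T r C.
case: forallP => [noc|chi]; last first.
  case: (boolP (tree_iso S dot_tree)) => [/iso_card|_]; last by rewrite mulr0.
  rewrite card_unit card_sig => /eqP/cards1P[x xE]; case: chi => d; apply/negP => dr.
  have := child_in_subtree dr; have := subtree_root T r C.
  by rewrite xE !inE => /eqP rx /eqP dx; case/and3P: dr; rewrite rx dx eqxx.
have DE (x : {x | x \in subtree T r C}) : val x = r.
  apply/eqP/negPn/negP => xr; have [d dr _] := subtree_child (valP x) xr.
  by have := noc d; rewrite (dr : child r C d).
have all1 (x y : {x | x \in subtree T r C}) : x = y by apply: val_inj; rewrite !DE.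
have -> : tree_iso S dot_tree.
  apply/isoP; exists (fun=> tt) => [|x]; last by case: (parent _ _).
  by apply: (@Bijective _ _ _ (fun=> tree_root S)) => [x|[]//]; apply: all1.
rewrite mulr1; suff -> : tree_aut S = [set 1%g] by rewrite cards1.
apply/setP => s; rewrite !inE; apply/forallP/eqP => [_|_ x]; last exact/eqP/all1.
by apply/permP => x; apply: all1.
Qed.

(** The induction keeps r fixed and lets C grow: the induction hypothesis is needed only for the
    tree at r with one more cut, while the branches at the children are handled by
    [deriv_tbinom_sub]. *)
Lemma tbinom_sub_rtree r C :
  tbinom P (sub_rtree T r C) =
  \prod_(d | child r C d) indef_sum K0 (tbinom P (sub_rtree T d C)).
Proof.
have [n] := ubnP #|subtree T r C|; elim: n C => // n IHn C Cn.
(* In characteristic zero it suffices that the difference of the two sides has value 0 at 0 and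
   derivative 0. At 0 the product is 1 if it is empty and 0 otherwise, since indefinite sums vanish
   there. *)
apply/eqP; rewrite -subr_eq0; apply/eqP; rewrite [LHS](poly_const K0).
  rewrite -horner_coef0 hornerD hornerN tbinom_sub_horner0 horner_prod.
  case: (boolP [forall d, _]) => [/forallP noc|/forallPn[d]].
    by rewrite big_pred0 ?subrr // => d; apply/negbTE/noc.
  by rewrite negbK => dr; rewrite (bigD1 d) //= indef_sum0 mul0r subrr.
(* Both derivatives are now sums over the children d of r, and they are compared for each d
   separately. *)
rewrite derivB deriv_tbinom_sub sum_subtree deriv_prod -sumrB big1 // => d dr.
rewrite deriv_indef_sum deriv_tbinom_sub indef_sum_sum mulrDl.
have dD := child_in_subtree dr; have [/eqP pd d_r dC] := and3P dr.
have IH c : c \in subtree T d C ->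
    tbinom P (sub_rtree T r (c |: C)) =
    \prod_(e | child r (c |: C) e) indef_sum K0 (tbinom P (sub_rtree T e (c |: C))).
  move=> cD; have cr : c != r.
    by apply: contraTneq cD => ->; apply: child_notin_subtree dr.
  apply: IHn; rewrite -ltnS; apply: leq_trans Cn; rewrite ltnS.
  rewrite -(card_subtree_cut (subtree_trans dD cD) cr) -add1n leq_add2r.
  by apply/card_gt0P; exists c; apply: subtree_root.
(* A cut inside the branch at d leaves the sibling branches unchanged, by disjointness. *)
have other c e : c \in subtree T d C -> child r C e -> e != d ->
    tbinom P (sub_rtree T e (c |: C)) = tbinom P (sub_rtree T e C).
  move=> cD er ed; apply: sub_rtree_setU1; apply: contra ed => ce.
  by rewrite (child_unique er dr ce cD).
apply/eqP; rewrite subr_eq0; apply/eqP.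
(* The vertex c = d matches the umbral summand of [deriv_indef_sum]: cutting at d just removes d
   from the children of r. *)
rewrite (bigD1 d) ?subtree_root //=; congr (_ + _).
  rewrite IH ?subtree_root //; congr (_ * _); apply: eq_big => [e|e].
    by rewrite /child in_setU1 negb_or andbA andbAC -!andbA; do !bool_congr.
  rewrite /child in_setU1 negb_or => /and4P[pe er ed eC].
  by rewrite other ?subtree_root // /child pe er.
(* A vertex c strictly inside the branch at d is not a child of r, so cutting there keeps all the
   children and alters only the factor at d. *)
rewrite mulr_suml; apply: eq_bigr => c /andP[cD cd].
have childE e : child r (c |: C) e = child r C e.
  rewrite /child in_setU1 negb_or; have [->|//] := eqVneq e c.
  apply/and3P/and3P => -[/eqP pc cr //].
  move: cD; rewrite in_subtree // pc => /andP[_].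
  by rewrite (negPf (child_notin_subtree _ dr)).
rewrite IH // indef_sumC -mulrA; congr (_ * _).
rewrite (eq_bigl _ _ childE) (bigD1 d) //=; congr (_ * _).
by apply: eq_bigr => e /andP[er ed]; rewrite other.
Qed.

End Cut.

(** * Branches of a joined tree, and the formula for it *)

Lemma join_branch k (V : 'I_k -> finType) (T : forall i, rtree (V i)) i :
  tree_iso (T i) (sub_rtree (join_tree T) (Some (Tagged V (tree_root (T i)))) set0).
Proof.
set J := join_tree T; set r := Some _.
have JE x : parent J x = join_parent T x by rewrite /parent /= ffunE.
pose f := [ffun v : V i => Some (Tagged V v)].
have fp v : f (parent (T i) v) = cut_parent J r set0 (f v).
  rewrite /cut_parent in_set0 orbF JE !ffunE /=.
  have [->|vr] := eqVneq v (tree_root (T i)); first by rewrite parent_root eqxx.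
  case: eqP => // -[] /eqP; rewrite eq_Tagged /= (negPf vr) //.
apply/sub_rtreeP; exists f; apply/embeddingsP; split=> //.
  by move=> v w; rewrite !ffunE => -[] /eqP; rewrite eq_Tagged => /eqP.
move=> x; apply/codomP/idP => [[v ->]|].
  elim/(@rtree_ind _ (T i)): v => [|v vr IHv]; first by rewrite ffunE subtree_root.
  have := IHv; rewrite fp; rewrite /cut_parent in_set0 orbF.
  by case: eqP => // /eqP fr; rewrite [in X in _ -> X]in_subtree // in_set0.
(* Nothing else lies in the branch: below its top, a vertex whose parent is in the i-th summand is
   in that summand too, as [join_parent] keeps the index i. *)
elim/(@rtree_ind _ J): x => [/root_in_subtree//|x _ IHx].
have [->|xr] := eqVneq x r; first by exists (tree_root (T i)); rewrite ffunE.
rewrite in_subtree // => /andP[_ /IHx[v]]; rewrite JE ffunE.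
case: x xr {IHx} => [[j w]|] //= wr.
case: eqP => // _ [] ij; move: w wr; rewrite ij => w wr _.
by exists w; rewrite ffunE.
Qed.

End Solution.

Theorem theorem2p22 (K : fieldType) (K0 : [pchar K] =i pred0)
    (P : tree_series {poly K}) (solP : is_solution P)
    (k : nat) (k_gt0 : (0 < k)%N)
    (V : 'I_k -> finType) (T : forall i : 'I_k, rtree (V i)) :
  tbinom P (join_tree T) = \prod_(i < k) indef_sum K0 (tbinom P (T i)).
Proof.
set J := join_tree T.
have JE x : parent J x = join_parent T x by rewrite /parent /= ffunE.
(* With no cuts, the branch at the root is the whole tree, which makes [tbinom_sub_rtree] applicable
   to J. *)
have Jiso : tree_iso J (sub_rtree J (tree_root J) set0).
  apply/sub_rtreeP; exists [ffun x => x]; apply/embeddingsP; split.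
  - by move=> x y; rewrite !ffunE.
  - move=> x; have -> : x \in codom [ffun x => x].
      by apply/codomP; exists x; rewrite ffunE.
    elim/(@rtree_ind _ J): x => [|x xr IHx]; first by rewrite subtree_root.
    by rewrite in_subtree // in_set0.
  - move=> x; rewrite !ffunE /cut_parent in_set0 orbF.
    by case: eqP => // ->; rewrite parent_root.
rewrite (tbinom_iso _ Jiso) (tbinom_sub_rtree K0 solP).
pose h i := Some (Tagged V (tree_root (T i))).
have hI : injective h by move=> i j [].
(* The children of the root of J are the roots of the trees [T i], and injectivity of h reindexes
   the product over them by i. *)
rewrite (eq_bigl (mem (h @: setT))) => [|x].
  rewrite big_imset /= => [|i j _ _ /hI//]; apply: eq_big => [i|i _]; first by rewrite inE.
  by rewrite (tbinom_iso _ (join_branch T i)).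
rewrite /child in_set0 andbT JE; apply/andP/imsetP => [|[i _ ->]]; last by rewrite /= eqxx.
case: x => [[i v]|] /= [] //; have [->|//] := eqVneq v (tree_root (T i)) => _ _.
by exists i.
Qed.
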